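(* Let $\nu\in(0,1)$ and let $M^\nu(\cdot)$ be the process defined by $M^\nu(t):=M(\mathcal{L}^\nu(t))=\sum_{k=1}^{N_\lambda(\mathcal{L}^\nu(t))}X_k$, where $M(t):=\sum_{k=1}^{N_\lambda(t)}X_k$, $\{X_n:n\geq 1\}$ is a sequence of i.i.d. positive and integer valued random variables, independent of a Poisson process $\{N_\lambda(t):t\geq 0\}$ with intensity $\lambda$. Then the compound process $M^\nu(\cdot)$ exhibits overdispersion, that is, $$\mathrm{Var}[M^\nu(t)]-\mathbb{E}[M^\nu(t)]>0\qquad\text{for all } t>0.$$
   Context: A real valued random variable $Y$ is said to be overdispersed if $\mathrm{Var}[Y]-\mathbb{E}[Y]>0$; a process $Y(\cdot)$ exhibits overdispersion if all the random variables $\{Y(t):t>0\}$ are overdispersed. For $\nu\in(0,1)$, $\mathcal{A}^\nu(\cdot)$ is the stable subordinator of order $\nu$, i.e. the L\'evy process starting at the origin such that $\mathbb{E}[e^{\theta\mathcal{A}^\nu(t)}]=\exp(-(-\theta)^\nu t)$ for $\theta\leq 0$ (and $=\infty$ for $\theta>0$), for each fixed $t>0$. Its inverse is $\mathcal{L}^\nu(t):=\inf\{z:\mathcal{A}^\nu(z)>t\}$. The random time-change $\mathcal{L}^\nu(\cdot)$ is independent of $M(\cdot)$, that is, of $N_\lambda(\cdot)$ and $\{X_n:n\geq 1\}$. *)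

(* Defs.v *)
From HB Require Import structures.
From mathcomp Require Import all_boot all_order all_algebra finmap.
From mathcomp Require Import all_classical all_reals all_analysis.

Set Implicit Arguments.
Unset Strict Implicit.
Unset Printing Implicit Defensive.

Import Order.TTheory GRing.Theory Num.Theory.
Import numFieldNormedType.Exports.

Local Open Scope classical_set_scope.
Local Open Scope ring_scope.

Section independence.
Context d (T : measurableType d) (R : realType) (P : probability T R).

Definition independent_systems (F G : set (set T)) : Prop :=
  forall E E', F E -> G E' -> P (E `&` E') = (P E * P E')%E.

Definition mutually_independent (I : choiceType) (F : I -> set (set T)) :
  Prop :=
  forall (J : {fset I}) (E : I -> set T), (forall i, i \in J -> F i (E i)) ->
    P (\bigcap_(i in [set` J]) E i) = (\prod_(i <- J) P (E i))%E.

Definition sigma_of d' (U : measurableType d') (Y : T -> U) : set (set T) :=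
  preimage_set_system setT Y measurable.

Definition sigma_of_family (I : Type) (D : set I) d' (U : measurableType d')
  (Y : I -> T -> U) : set (set T) :=
  <<s \bigcup_(i in D) sigma_of (Y i) >>.

Definition same_law d' (U : measurableType d') (Y Z : T -> U) : Prop :=
  forall B : set U, measurable B -> P (Y @^-1` B) = P (Z @^-1` B).

Record iid d' (U : measurableType d') (X : nat -> T -> U) : Prop := Iid {
  iid_measurable : forall n, measurable_fun setT (X n) ;
  iid_independent : mutually_independent (fun n => sigma_of (X n)) ;
  iid_same_law : forall n, same_law (X n) (X 0%N) }.

End independence.

(* Processes are indexed by R; only their values at times t >= 0 matter. *)
Definition times (R : realType) : set R := [set t | 0 <= t].

Definition cadlag (R : realType) (f : R -> R) : Prop :=
  (forall t : R, 0 <= t -> f x @[x --> t^'+] --> f t) /\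
  (forall t : R, 0 < t -> cvg (f x @[x --> t^'-])).

Section processes.
Context d (T : measurableType d) (R : realType) (P : probability T R).

Record levy_process (Y : R -> T -> R) : Prop := LevyProcess {
  levy_measurable : forall t : R, 0 <= t -> measurable_fun setT (Y t) ;
  levy_start : {ae P, forall w, Y 0 w = 0} ;
  (* Finitely many times t_0 <= ... <= t_n are covered by extending the
     sequence by the constant t_n. *)
  levy_independent_increments : forall t : nat -> R, 0 <= t 0%N ->
    (forall i, t i <= t i.+1) ->
    mutually_independent P (fun i => sigma_of (Y (t i.+1) \- Y (t i))) ;
  levy_stationary_increments : forall s t : R, 0 <= s -> 0 <= t ->
    same_law P (Y (s + t) \- Y s) (Y t) ;
  levy_paths : {ae P, forall w, cadlag (Y ^~ w)} }.

Record poisson_process (lambda : R) (N : R -> T -> nat) : Prop :=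
  PoissonProcess {
  poisson_levy : levy_process (fun t w => (N t w)%:R) ;
  (* t = 0 is left to [levy_start]: [poisson_pmf 0 k] is not the Dirac mass *)
  poisson_marginal : forall t : R, 0 < t -> forall k,
    P [set w | N t w = k] = (poisson_pmf (lambda * t) k)%:E }.

Record stable_subordinator (nu : R) (A : R -> T -> R) : Prop :=
  StableSubordinator {
  stable_levy : levy_process A ;
  stable_mgf_le0 : forall t theta : R, 0 < t -> theta <= 0 ->
    'M_P (A t) theta = (expR (- ((- theta) `^ nu * t)))%:E ;
  stable_mgf_gt0 : forall t theta : R, 0 < t -> 0 < theta ->
    'M_P (A t) theta = +oo%E }.

(* [inf set0 = 0], so this is real valued everywhere; for a stable
   subordinator the set is nonempty almost surely. *)
Definition inverse_process (A : R -> T -> R) (t : R) (w : T) : R :=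
  inf [set z | 0 <= z /\ t < A z w].

(* The sequence is indexed from 0: X k is the (k+1)-st summand. *)
Definition compound_process (N : R -> T -> nat) (X : nat -> T -> nat)
  (t : R) (w : T) : R := (\sum_(k < N t w) X k w)%:R.

Definition time_change (M L : R -> T -> R) (t : R) (w : T) : R :=
  M (L t w) w.

Definition overdispersed (Y : T -> R) : Prop :=
  (0 < 'V_P[Y] - 'E_P[Y])%E.

Definition exhibits_overdispersion (Y : R -> T -> R) : Prop :=
  forall t : R, 0 < t -> overdispersed (Y t).

End processes.

(* Main.v *)
Require Import Defs.
From HB Require Import structures.
From mathcomp Require Import all_boot all_order all_algebra finmap.
From mathcomp Require Import all_classical all_reals all_analysis
  measurable_realfun.
From mathcomp Require Import ring lra.

Set Implicit Arguments.
Unset Strict Implicit.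
Unset Printing Implicit Defensive.

Import Order.TTheory GRing.Theory Num.Theory.
Import numFieldNormedType.Exports.

Local Open Scope classical_set_scope.
Local Open Scope ring_scope.

(* Let mu be the mean of the summands, S n = X_0 + ... + X_(n-1), and let C n be
   the sum of X_i X_j over i <> j < n.  Since the summands are integers,
   S n ^ 2 >= C n + S n.  Conditionally on L = L^nu(t) the factorial moments of
   N(L) are the powers of lambda L, so E[S (N L)] = lambda mu E[L] and
   E[C (N L)] = (lambda mu)^2 E[L^2].  Hence
     Var M - E M >= E[C (N L)] - (E M)^2 = (lambda mu)^2 Var L > 0,
   because L is integrable and not almost surely constant.  The conditioning is
   made elementary by sampling N at the points of the grid of mesh 1 / (m + 1)
   next to L: N being almost surely nondecreasing and right-continuous, these
   samples bracket N(L), and only two one-sided estimates are needed.  When M is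
   not square integrable its variance is infinite. *)

(** * Natural-number valued random variables *)

Section nat_valued_measurability.
Context d (T : measurableType d).

Lemma measurable_nat_preimage (Y : T -> nat) (B : set nat) :
  measurable_fun setT Y -> measurable (Y @^-1` B).
Proof. by move=> mY; rewrite -[X in measurable X]setTI; exact: mY. Qed.

Lemma measurable_fun_nat_comp d' (U : measurableType d') (f : nat -> U)
    (Y : T -> nat) :
  measurable_fun setT Y -> measurable_fun setT (f \o Y).
Proof.
move=> mY _ B _; rewrite setTI comp_preimage; exact: measurable_nat_preimage.
Qed.

(** A preimage is cut into countably many pieces along the values of [K]. *)
Lemma measurable_fun_random_index d' (U : measurableType d') (K : T -> nat)
    (Y : nat -> T -> U) :
  measurable_fun setT K -> (forall k, measurable_fun setT (Y k)) ->
  measurable_fun setT (fun w => Y (K w) w).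
Proof.
move=> mK mY _ B mB; rewrite setTI.
rewrite (_ : _ @^-1` _ = \bigcup_k (K @^-1` [set k] `&` Y k @^-1` B)).
  apply: bigcupT_measurable => k; apply: measurableI.
    exact: measurable_nat_preimage.
  by rewrite -[X in measurable X]setTI; exact: mY.
by apply/seteqP; split=> [w Bw|w [k _ [/= <-]]//]; exists (K w).
Qed.

Lemma measurable_fun_nat_comp2 (h : nat -> nat -> nat) (Y Z : T -> nat) :
  measurable_fun setT Y -> measurable_fun setT Z ->
  measurable_fun setT (fun w => h (Y w) (Z w)).
Proof.
move=> mY mZ.
apply: (@measurable_fun_random_index _ _ _ (fun k w => h k (Z w))) => // k.
exact: measurable_fun_nat_comp.
Qed.

Lemma measurable_fun_nat_sum (I : Type) (s : seq I) (p : pred I)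
    (Y : I -> T -> nat) :
  (forall i, measurable_fun setT (Y i)) ->
  measurable_fun setT (fun w => \sum_(i <- s | p i) Y i w)%N.
Proof.
move=> mY; elim: s => [|i s ih].
  rewrite (_ : (fun _ => _) = cst 0%N); first exact: measurable_cst.
  by apply/funext => w; rewrite big_nil.
rewrite (_ : (fun _ => _) = (fun w =>
    if p i then Y i w + \sum_(j <- s | p j) Y j w else
    \sum_(j <- s | p j) Y j w)%N); last first.
  by apply/funext => w; rewrite big_cons.
by case: (p i) => //; exact: (measurable_fun_nat_comp2 addn).
Qed.

Lemma measurable_natr (R : realType) (Y : T -> nat) :
  measurable_fun setT Y -> measurable_fun setT (fun w => (Y w)%:R : R).
Proof. exact: measurable_fun_nat_comp. Qed.

End nat_valued_measurability.

Section nat_valued_integrals.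
Local Open Scope ereal_scope.
Context d (T : measurableType d) (R : realType) (P : probability T R).
Implicit Types (Y K : T -> nat) (A : set T).

Lemma nneseries_single (a : nat -> \bar R) n :
  (forall k, 0 <= a k) -> (forall k, k != n -> a k = 0) ->
  \sum_(k <oo) a k = a n.
Proof.
move=> a0 an; rewrite (@nneseriesD1 _ _ n)// eseries0 ?adde0// => k _ /= kn.
exact: an.
Qed.

Lemma nat_nneseries_indic (n : nat) :
  n%:R%:E = \sum_(k <oo) (k < n)%N%:R%:E :> \bar R.
Proof.
rewrite (@nneseries_split _ _ 0%N n)// add0n eseries0 ?adde0; last first.
  by move=> k nk _; rewrite ltnNge nk.
rewrite sumEFin; congr EFin; rewrite -natr_sum; congr (_%:R).
rewrite big_mkord (eq_bigr (fun=> 1%N)) => [|i _]; last by rewrite ltn_ord.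
by rewrite sum1_card card_ord.
Qed.

Lemma measurable_EFin_natr Y :
  measurable_fun setT Y ->
    measurable_fun setT (EFin \o (fun w => (Y w)%:R : R)).
Proof. by move=> mY; apply/measurable_EFinP; exact: measurable_natr. Qed.

(** [Y] is the sum over [n] of the indicators of [n < Y]. Expectations thus reduce to probabilities,
    to which equality of laws and independence apply directly. *)
Lemma integral_nat_tail Y : measurable_fun setT Y ->
  \int[P]_w (Y w)%:R%:E = \sum_(n <oo) P (Y @^-1` [set k | (n < k)%N]).
Proof.
move=> mY; under eq_integral do rewrite nat_nneseries_indic.
rewrite integral_nneseries//; last first.
  move=> n; apply/measurable_EFinP/measurable_natr.
  by apply: (measurable_fun_nat_comp (fun k => nat_of_bool (n < k)%N)).
apply: eq_eseriesr => n _; set A := (X in P X).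
rewrite -(setIT A) -integral_indic//; last exact: measurable_nat_preimage.
apply: eq_integral => w _; rewrite indicE; congr (_%:R%:E).
by congr nat_of_bool; apply/idP/idP; rewrite inE.
Qed.

Lemma integral_nat_sum (I : Type) (s : seq I) (p : pred I) (Y : I -> T -> nat) :
  (forall i, measurable_fun setT (Y i)) ->
  \int[P]_w (\sum_(i <- s | p i) Y i w)%:R%:E =
  \sum_(i <- s | p i) \int[P]_w (Y i w)%:R%:E :> \bar R.
Proof.
move=> mY; elim: s => [|i s ih].
  by rewrite big_nil; apply: integral0_eq => w _; rewrite big_nil.
rewrite big_cons -ih; under eq_integral do rewrite big_cons.
case: (p i) => //; under eq_integral do rewrite natrD EFinD.
rewrite ge0_integralD//; first exact: measurable_EFin_natr.
by apply: measurable_EFin_natr; exact: measurable_fun_nat_sum.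
Qed.

(** The tail events of [Y] times the indicator of [A] are those of [Y] intersected with [A], so the
    tail sum factorizes term by term. *)
Lemma integral_nat_indep_indic Y A : measurable_fun setT Y -> measurable A ->
  (forall B : set nat, P (Y @^-1` B `&` A) = P (Y @^-1` B) * P A) ->
  \int[P]_w ((Y w)%:R%:E * (\1_A w)%:E) = \int[P]_w (Y w)%:R%:E * P A.
Proof.
move=> mY mA YA.
have mZ : measurable_fun setT (fun w => Y w * (w \in A))%N.
  apply: (measurable_fun_nat_comp2 muln) => //.
  have mb : measurable_fun setT (fun w => w \in A).
    apply: (measurable_fun_bool true); rewrite setTI.
    by rewrite (_ : _ @^-1` _ = A)//; apply/seteqP; split => w /=;
      [exact: set_mem | exact: mem_set].
  by move=> _ B _; have := mb measurableT (nat_of_bool @^-1` B); exact.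
under eq_integral => w _ do rewrite indicE -EFinM -natrM.
rewrite (integral_nat_tail mZ) (integral_nat_tail mY).
rewrite -(fineK (fin_num_measure P A mA)) muleC -nneseriesZl//.
apply: eq_eseriesr => n _; rewrite fineK ?fin_num_measure// muleC -YA.
congr (P _); apply/seteqP; split => w /=.
  case: (boolP (w \in A)) => [wA|]; last by rewrite muln0.
  by rewrite muln1; split => //; exact: set_mem.
by move=> [nY /mem_set ->]; rewrite muln1.
Qed.

Lemma integral_nat_fun K (f : nat -> \bar R) : measurable_fun setT K ->
  (forall k, 0 <= f k) ->
  \int[P]_w f (K w) = \sum_(k <oo) f k * P (K @^-1` [set k]).
Proof.
move=> mK f0.
have mA k := measurable_nat_preimage [set k] mK.
transitivity (\int[P]_w \sum_(k <oo) (f k * (\1_(K @^-1` [set k]) w)%:E)).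
  apply: eq_integral => w _; rewrite (@nneseries_single _ (K w)) //.
  - by rewrite indicE mem_set// mule1.
  - by move=> k; rewrite mule_ge0// lee_fin.
  - by move=> k /eqP kK; rewrite indicE memNset ?mule0// => /= /esym.
rewrite integral_nneseries//; last 2 first.
- move=> k; apply: measurable_funeM; apply/measurable_EFinP.
  exact: measurable_indic.
- by move=> k w _; rewrite mule_ge0// lee_fin.
apply: eq_eseriesr => k _; rewrite ge0_integralZl//.
- by rewrite integral_indic// setIT.
- by apply/measurable_EFinP; exact: measurable_indic.
Qed.

(** This is elementary conditioning on [K]: the integral is split along the events [K = k], each of
    which is independent of [Y k]. *)
Lemma integral_random_index K (Y : nat -> T -> nat) : measurable_fun setT K ->
  (forall k, measurable_fun setT (Y k)) ->
  (forall k (B : set nat), P (Y k @^-1` B `&` K @^-1` [set k]) =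
    P (Y k @^-1` B) * P (K @^-1` [set k])) ->
  \int[P]_w (Y (K w) w)%:R%:E =
  \int[P]_w (fun k => \int[P]_w' (Y k w')%:R%:E) (K w).
Proof.
move=> mK mY YK.
have mA k := measurable_nat_preimage [set k] mK.
rewrite (@integral_nat_fun K (fun k => \int[P]_w' (Y k w')%:R%:E))//;
  last first.
  by move=> k; apply: integral_ge0 => w _; rewrite lee_fin.
transitivity (\int[P]_w
    \sum_(k <oo) ((Y k w)%:R%:E * (\1_(K @^-1` [set k]) w)%:E)).
  apply: eq_integral => w _; rewrite (@nneseries_single _ (K w)) //.
  - by rewrite indicE mem_set// mule1.
  - by move=> k /eqP kK; rewrite indicE memNset ?mule0// => /= /esym.
rewrite integral_nneseries//; last first.
  move=> k; apply: emeasurable_funM; first exact: measurable_EFin_natr.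
  by apply/measurable_EFinP; exact: measurable_indic.
by apply: eq_eseriesr => k _; rewrite integral_nat_indep_indic.
Qed.

End nat_valued_integrals.

Lemma measurable_fun_natP d (T : measurableType d) (Y : T -> nat) :
  (forall n, measurable [set w | (n < Y w)%N]) -> measurable_fun setT Y.
Proof.
move=> mY _ B _; rewrite setTI.
have -> : Y @^-1` B = \bigcup_(n in B) Y @^-1` [set n].
  by apply/seteqP; split=> [w Bw|w [n Bn /= ->]//]; exists (Y w).
apply: bigcup_measurable => n _.
case: n => [|n].
  rewrite (_ : _ @^-1` _ = ~` [set w | (0 < Y w)%N]); first exact: measurableC.
  by apply/seteqP; split => w /=; rewrite lt0n; [move=> -> | move=> /negP;
    rewrite negbK => /eqP].
rewrite (_ : _ @^-1` _ = [set w | (n < Y w)%N] `\` [set w | (n.+1 < Y w)%N]).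
  exact: measurableD.
apply/seteqP; split => w /= => [->|[nY /negP]]; first by rewrite ltnn.
by rewrite -leqNgt => Yn; apply/eqP; rewrite eqn_leq Yn.
Qed.

Lemma measurable_truncn (R : realType) :
  measurable_fun setT (Num.truncn : R -> nat).
Proof.
apply: measurable_fun_natP => n;
  rewrite (_ : [set _ | _] = `[n.+1%:R, +oo[%classic).
  exact: measurable_itv.
by apply/seteqP; split => x /=; rewrite truncn_gt_nat in_itv/= andbT.
Qed.

(** * Poisson and partial-sum moments *)

Section poisson_moments.
Local Open Scope ereal_scope.
Context (R : realType).

(** The terms below [j] vanish. After a shift by [j] the falling factorial cancels against the
    factorial, and [r ^+ j] times the total Poisson mass remains. *)
Lemma poisson_factorial_moment (r : R) j : (0 < r)%R ->
  \sum_(n <oo) (n ^_ j)%:R%:E * (poisson_pmf r n)%:E = (r ^+ j)%:E.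
Proof.
move=> r0.
have f0 n : 0 <= (n ^_ j)%:R%:E * (poisson_pmf r n)%:E.
  by rewrite -EFinM lee_fin mulr_ge0// poisson_pmf_ge0.
rewrite (@nneseries_split _ _ 0%N j)// add0n big1_seq ?add0e; last first.
  move=> n /=; rewrite mem_index_iota => /andP[_ nj].
  by rewrite ffact_small// mul0e.
rewrite -(nneseries_addn j f0).
transitivity (\sum_(n <oo) ((r ^+ j)%:E * (poisson_pmf r n)%:E)).
  apply: eq_eseriesr => n _; rewrite -!EFinM; congr EFin.
  rewrite /poisson_pmf r0 -(ffact_fact (leq_addl n j)) addnK natrM.
  have nz1 : n`!%:R != 0%R :> R by rewrite pnatr_eq0 -lt0n fact_gt0.
  have nz2 : ((n + j) ^_ j)%:R != 0%R :> R.
    by rewrite pnatr_eq0 -lt0n ffact_gt0 leq_addl.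
  by rewrite exprD; field; rewrite nz1.
rewrite nneseriesZl; last by move=> n _; rewrite lee_fin poisson_pmf_ge0.
rewrite (_ : \sum_(n <oo) _ = 1) ?mule1//.
have := probability_setT (poisson_prob r 0); rewrite /= /poisson_prob r0.
by rewrite -nneseries_esumT// => n; rewrite lee_fin poisson_pmf_ge0.
Qed.

Context d (T : measurableType d) (P : probability T R).

Lemma integral_poisson_ffact (K : T -> nat) (r : R) j : (0 < r)%R ->
  measurable_fun setT K ->
  (forall k, P [set w | K w = k] = (poisson_pmf r k)%:E) ->
  \int[P]_w (K w ^_ j)%:R%:E = (r ^+ j)%:E.
Proof.
move=> r0 mK PK.
rewrite (integral_nat_fun P (f := fun k => (k ^_ j)%:R%:E))//.
rewrite -(@poisson_factorial_moment r j)//.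
by apply: eq_eseriesr => k _; congr (_ * _); exact: PK.
Qed.

End poisson_moments.

(** * Sigma-algebras generated by families *)

Section generated_families.
Context d (T : measurableType d) (I : Type) (D : set I).
Context d' (U : measurableType d') (Y : I -> T -> U).

Lemma sigma_of_familyP i (B : set U) : D i -> measurable B ->
  sigma_of_family D Y (Y i @^-1` B).
Proof.
move=> Di mB; apply: sub_sigma_algebra; exists i => //.
by exists B; rewrite ?setTI.
Qed.

(** Equipping the sample space with a generated sigma-algebra turns membership of events in it into
    measurability, so that closure properties of measurable functions apply. *)
Lemma measurable_fun_sigma_of_family (G : set (set T)) i : D i ->
  sigma_of_family D Y `<=` <<s G >> ->
  measurable_fun setT (Y i : g_sigma_algebraType G -> U).
Proof.
by move=> Di YG _ B mB; rewrite setTI; apply: YG; exact: sigma_of_familyP.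
Qed.

End generated_families.

(** * Moments of sums of i.i.d. variables *)

Section iid_moments.
Local Open Scope ereal_scope.
Context d (T : measurableType d) (R : realType) (P : probability T R).
Variables (X : nat -> T -> nat) (hX : iid P X).

Definition psum n w := (\sum_(k < n) X k w)%N.

Definition cross n w := (\sum_(i < n) \sum_(j < n | j != i) X i w * X j w)%N.

(** The diagonal terms of the expanded square satisfy [x <= x * x], as holds for natural numbers. *)
Lemma cross_psum n w : (cross n w + psum n w <= psum n w * psum n w)%N.
Proof.
rewrite /cross /psum -big_split/= big_distrl/=; apply: leq_sum => i _.
rewrite big_distrr/= [leqRHS](bigD1 i)//= addnC leq_add2r.
by case: (X i w) => // x; rewrite leq_pmull.
Qed.

Lemma psum_mono m n w : (m <= n)%N -> (psum m w <= psum n w)%N.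
Proof.
move=> mn; rewrite /psum (big_ord_widen n (X ^~ w) mn) big_mkcond/=.
by apply: leq_sum => i _; case: ifP.
Qed.

Lemma cross_mono m n w : (m <= n)%N -> (cross m w <= cross n w)%N.
Proof.
move=> mn; rewrite /cross.
rewrite (big_ord_widen n
  (fun i => \sum_(j < m | j != i :> nat) X i w * X j w)%N mn) big_mkcond/=.
apply: leq_sum => i _; case: ifP => // _.
rewrite (big_ord_widen_cond n (fun j => j != i) (fun j => X i w * X j w)%N mn).
by rewrite [leqRHS](bigID (fun j : 'I_n => (j < m)%N))/= leq_addr.
Qed.

Lemma integral_iid n : \int[P]_w (X n w)%:R%:E = \int[P]_w (X 0%N w)%:R%:E :>
  \bar R.
Proof.
rewrite !integral_nat_tail; [|exact: (iid_measurable hX)..].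
by apply: eq_eseriesr => k _; exact: (iid_same_law hX).
Qed.

Lemma iid_pair i j (A B : set nat) : i != j ->
  P (X i @^-1` A `&` X j @^-1` B) = P (X i @^-1` A) * P (X j @^-1` B).
Proof.
move=> ij.
(* Only the values at [i] and [j] matter; the second event serves as default at the other
   indices. *)
pose E k := if k == i then X i @^-1` A else X j @^-1` B.
have := @iid_independent _ _ _ _ _ _ _ hX [fset i; j]%fset E.
rewrite big_fsetU1/= ?inE// big_seq_fset1 /E eqxx eq_sym (negbTE ij) => <-.
  congr (P _); apply/seteqP; split => [w [/= Aw Bw] k /=|w /= /(_ _ _)H].
    by rewrite !inE => /orP[]/eqP ->; rewrite ?eqxx// eq_sym (negbTE ij).
  split.
    by have := H i; rewrite /= !inE eqxx => /(_ isT).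
  by have := H j; rewrite /= !inE eqxx orbT eq_sym (negbTE ij) => /(_ isT).
move=> k; rewrite !inE => /orP[]/eqP ->.
  by rewrite eqxx; exists A; rewrite ?setTI.
by rewrite eq_sym (negbTE ij); exists B; rewrite ?setTI.
Qed.

Hypothesis X_fin : \int[P]_w (X 0%N w)%:R%:E \is a @fin_num R.

Let mu : R := fine (\int[P]_w (X 0%N w)%:R%:E).

Let muE : \int[P]_w (X 0%N w)%:R%:E = mu%:E. Proof. by rewrite fineK. Qed.

(** Given [X i = k] the mean is [k * mu], and integrating over [k] gives the second factor [mu]. *)
Lemma integral_iid_mul i j : i != j ->
  \int[P]_w (X i w * X j w)%:R%:E = (mu ^+ 2)%:E.
Proof.
move=> ij; have mX := iid_measurable hX.
rewrite (integral_random_index (P := P) (K := X i)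
  (Y := fun k w => k * X j w)%N)//.
- under eq_integral => w _.
    under eq_integral do rewrite natrM EFinM.
    rewrite ge0_integralZl//; last exact: measurable_EFin_natr.
    rewrite integral_iid muE; over.
  rewrite ge0_integralZr//=; last 2 first.
  - exact: measurable_EFin_natr.
  - by rewrite lee_fin fine_ge0// integral_ge0.
  by rewrite integral_iid muE -EFinM -expr2.
- by move=> k; exact: measurable_fun_nat_comp.
- move=> k B; rewrite setIC muleC.
  exact: (iid_pair [set k] ((fun x => k * x)%N @^-1` B) ij).
Qed.

(** The mean is written with a falling factorial so that this case and that of [cross] share one
    form. *)
Lemma integral_psum n : \int[P]_w (psum n w)%:R%:E = ((n ^_ 1)%:R * mu)%:E.
Proof.
rewrite integral_nat_sum; last by move=> i; exact: (iid_measurable hX).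
rewrite (eq_bigr (fun=> mu%:E)); last by move=> i _; rewrite integral_iid.
by rewrite sumEFin sumr_const card_ord ffactn1 mulr_natl.
Qed.

(** There are [n * n.-1 = n ^_ 2] ordered pairs of distinct indices. *)
Lemma integral_cross n :
  \int[P]_w (cross n w)%:R%:E = ((n ^_ 2)%:R * mu ^+ 2)%:E.
Proof.
have mXX i j : measurable_fun setT (fun w => X i w * X j w)%N.
  by apply: (measurable_fun_nat_comp2 muln); exact: (iid_measurable hX).
rewrite integral_nat_sum; last by move=> i; exact: measurable_fun_nat_sum.
rewrite (eq_bigr (fun=> (n.-1%:R * mu ^+ 2)%:E)).
  rewrite sumEFin sumr_const card_ord -(mulr_natl _ n) mulrA -natrM.
  by rewrite ffactnS ffactn1.
move=> i _; rewrite integral_nat_sum//.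
rewrite (eq_bigr (fun=> (mu ^+ 2)%:E)).
  rewrite sumEFin sumr_const mulr_natl; congr (_ *+ _)%:E.
  by rewrite cardC1 card_ord.
by move=> j ji; rewrite integral_iid_mul// eq_sym.
Qed.

End iid_moments.

(** * Paths of the Poisson process *)

Section poisson_process_facts.
Context d (T : measurableType d) (R : realType) (P : probability T R).
Variables (lambda : R) (N : R -> T -> nat).
Hypotheses (hlambda : 0 < lambda) (hN : poisson_process P lambda N).

(** The process is given as measurable through its real cast, which truncation undoes. *)
Lemma poisson_measurable t : 0 <= t -> measurable_fun setT (N t).
Proof.
move=> t0; have mN := levy_measurable (poisson_levy hN) t0.
rewrite (_ : N t = Num.truncn \o (fun w => (N t w)%:R : R)).
  by apply: measurableT_comp => //; exact: measurable_truncn.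
by apply/funext => w /=; rewrite natrK.
Qed.

Lemma poisson_start : {ae P, forall w, N 0 w = 0%N}.
Proof.
apply: filterS (levy_start (poisson_levy hN)) => w /eqP.
by rewrite pnatr_eq0 => /eqP.
Qed.

Lemma integral_poisson_process t j : 0 <= t -> (0 < j)%N ->
  (\int[P]_w (N t w ^_ j)%:R%:E = ((lambda * t) ^+ j)%:E)%E.
Proof.
rewrite le_eqVlt => /predU1P[<- j0|t0 _]; last first.
  apply: integral_poisson_ffact; first exact: mulr_gt0.
    exact/poisson_measurable/ltW.
  exact: poisson_marginal.
(* At time 0 the count is almost surely 0, and its falling factorial vanishes because [j] is
   positive. *)
rewrite mulr0 expr0n gtn_eqF//= -[RHS](integral0 P setT).
apply: ae_eq_integral => //.
  apply: measurable_EFin_natr;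
    apply: (measurable_fun_nat_comp (fun k => k ^_ j)%N).
  exact: poisson_measurable.
apply: filterS poisson_start => w -> _.
by rewrite ffact_small.
Qed.

(* The increment over [s, t] has the law of N (t - s), which is nonnegative. *)
Lemma poisson_le s t : 0 <= s -> s <= t ->
  {ae P, forall w, (N s w <= N t w)%N}.
Proof.
move=> s0 st; have t0 := le_trans s0 st.
have ms := poisson_measurable s0; have mt := poisson_measurable t0.
exists [set w | (N t w < N s w)%N]; split.
- rewrite (_ : [set _ | _] =
    (fun w => nat_of_bool (N t w < N s w)%N) @^-1` [set 1%N]).
    apply: measurable_nat_preimage.
    exact: (measurable_fun_nat_comp2 (fun a b => nat_of_bool (a < b)%N)).
  by apply/seteqP; split => w /=; [move=> ->|case: (_ < _)%N].
- have ts0 : 0 <= t - s by rewrite subr_ge0.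
  have := levy_stationary_increments (poisson_levy hN) s0 ts0
    (measurable_itv `]-oo, 0[).
  rewrite subrKC => h.
  rewrite (_ : (fun w => (N (t - s) w)%:R) @^-1` _ = set0) ?measure0 in h.
    rewrite -h; congr (P _); apply/seteqP.
    by split => w /=; rewrite in_itv/= subr_lt0 ltr_nat.
  by apply/seteqP; split => w //=; rewrite in_itv/= ltNge ler0n.
- by move=> w /= /negP; rewrite -ltnNge.
Qed.

End poisson_process_facts.

(** * Monotone step paths and the dense grid of times *)

Section monotone_paths.
Context (R : realType).

Definition grid (m k : nat) : R := k%:R / m.+1%:R.

Lemma grid_ge0 m k : 0 <= grid m k. Proof. by rewrite divr_ge0. Qed.

Lemma grid_dense (s e : R) : 0 <= s -> 0 < e ->
  exists m k, s < grid m k < s + e.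
Proof.
(* The first witness makes the mesh smaller than [e]; the second is the index of the first grid
   point strictly after [s]. *)
move=> s0 e0; exists (Num.truncn e^-1), (Num.truncn (s * (Num.truncn
  e^-1).+1%:R)).+1.
set m := (Num.truncn e^-1).+1.
have m0 : 0 < m%:R :> R by rewrite ltr0n.
rewrite /grid ltr_pdivlMr// ltr_pdivrMr// -/m truncnS_gt/=.
have lee : 1 < e * m%:R.
  by rewrite mulrC -ltr_pdivrMr// div1r truncnS_gt.
have : (Num.truncn (s * m%:R))%:R <= s * m%:R
  by rewrite truncn_le mulr_ge0// ltW.
by rewrite -natr1 mulrDl => h; apply: ler_ltD.
Qed.

(** Monotonicity is asked on the grid points only: they are countably many, so one null set serves
    all comparisons. Constancy to the right of every time extends it to arbitrary times. *)
Definition good_path (f : R -> nat) : Prop :=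
  (forall s, 0 <= s -> exists2 e, 0 < e & forall x, s < x < s + e ->
    f x = f s) /\
  (forall m k m' k', grid m k <= grid m' k' ->
    (f (grid m k) <= f (grid m' k'))%N).

Lemma good_path_grid_le (f : R -> nat) s m k : good_path f -> 0 <= s ->
  grid m k <= s -> (f (grid m k) <= f s)%N.
Proof.
move=> [rc mono] s0 gs; have [e e0 fe] := rc _ s0.
have [m' [k' /andP[sg gse]]] := grid_dense s0 e0.
rewrite -(fe (grid m' k')) ?sg//; apply: mono.
exact: le_trans gs (ltW sg).
Qed.

Lemma good_path_le_grid (f : R -> nat) s m k : good_path f -> 0 <= s ->
  s < grid m k -> (f s <= f (grid m k))%N.
Proof.
move=> [rc mono] s0 sg; have [e e0 fe] := rc _ s0.
(* The minimum keeps the intermediate grid point both in the interval of constancy and below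
   [grid m k]. *)
have e'0 : 0 < Num.min e (grid m k - s) by rewrite lt_min e0 subr_gt0.
have [m' [k' /andP[sg' ge']]] := grid_dense s0 e'0.
have lee : s + Num.min e (grid m k - s) <= s + e by rewrite lerD2l ge_min lexx.
have leg : s + Num.min e (grid m k - s) <= grid m k.
  by rewrite -lerBrDl ge_min lexx orbT.
rewrite -(fe (grid m' k')) ?sg' ?(lt_le_trans ge')//; apply: mono.
exact/ltW/(lt_le_trans ge').
Qed.

(** Distinct natural numbers are at distance at least 1, so right-continuity with tolerance 1 forces
    equality. *)
Lemma cadlag_nat_right_constant (f : R -> nat) s :
  cadlag (fun x => (f x)%:R : R) -> 0 <= s ->
  exists2 e, 0 < e & forall x, s < x < s + e -> f x = f s.
Proof.
move=> [rc _] s0; have /cvgrPdist_lt /(_ 1 ltr01)[e /= e0 fe] := rc _ s0.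
exists e => // x /andP[sx xse].
have /fe/(_ sx) : ball s e x.
  by rewrite /ball/= distrC ger0_norm ?subr_ge0 1?ltW// ltrBlDl.
have gap a b : (a < b)%N -> 1 <= `|b%:R - a%:R| :> R.
  by move=> ab; rewrite (le_trans _ (ler_norm _))// lerBrDl natr1 ler_nat.
move=> /= h; have [/gap|/gap|//] := ltngtP (f x) (f s).
  by rewrite leNgt h.
by rewrite leNgt distrC h.
Qed.

End monotone_paths.

Lemma poisson_good_path d (T : measurableType d) (R : realType)
    (P : probability T R) (lambda : R) (N : R -> T -> nat) :
  poisson_process P lambda N -> {ae P, forall w, good_path (N ^~ w)}.
Proof.
move=> hN.
have mono : {ae P, forall w, forall m k m' k',
    grid R m k <= grid R m' k' -> (N (grid R m k) w <= N (grid R m' k') w)%N}.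
  do 4 (apply: ae_foralln => ?).
  have [le|/negP nle] := boolP (grid R _ _ <= grid R _ _); last exact: aeW.
  by apply: filterS (poisson_le hN (grid_ge0 _ _ _) le) => w ?.
apply: filterS2 (levy_paths (poisson_levy hN)) mono => w cw mw.
by split=> // s s0; exact: cadlag_nat_right_constant.
Qed.

(** * Sampling at the grid points next to the random time *)

Section time_changed_moments.
Context d (T : measurableType d) (R : realType) (P : probability T R).
Variables (lambda : R) (N : R -> T -> nat) (X : nat -> T -> nat).
Variable L : R -> T -> R.
Hypotheses (hlambda : 0 < lambda) (hN : poisson_process P lambda N).
Hypothesis mX : forall n, measurable_fun setT (X n).
Hypothesis hXN : independent_systems P (sigma_of_family setT X)
  (sigma_of_family (@times R) N).
Hypothesis mL : forall t : R, 0 <= t -> measurable_fun setT (L t).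
Hypothesis hL : independent_systems P (sigma_of_family (@times R) L)
  <<s sigma_of_family (@times R) N `|` sigma_of_family setT X >>.

(** For nonnegative [L t w], this is the index of the last grid point not above it. *)
Definition level (m : nat) (t : R) (w : T) : nat :=
  Num.truncn (L t w * m.+1%:R).

Lemma measurable_level m t : 0 <= t -> measurable_fun setT (level m t).
Proof.
move=> t0; apply: measurableT_comp; first exact: measurable_truncn.
by apply: measurable_funM => //; exact: mL.
Qed.

Lemma sigma_level m t k : 0 <= t ->
  sigma_of_family (@times R) L (level m t @^-1` [set k]).
Proof.
move=> t0; rewrite (_ : _ @^-1` _ =
    L t @^-1` ((fun x => Num.truncn (x * m.+1%:R)) @^-1` [set k]))//.
apply: sigma_of_familyP => //; apply: measurable_nat_preimage.
apply: measurableT_comp; first exact: measurable_truncn.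
exact: measurable_funM.
Qed.

Lemma grid_level_le m t w : 0 <= L t w -> grid R m (level m t w) <= L t w.
Proof.
move=> L0; rewrite /grid ler_pdivrMr ?ltr0n// truncn_le mulr_ge0//.
Qed.

Lemma grid_level_gt m t w : L t w < grid R m (level m t w).+1.
Proof. by rewrite /grid ltr_pdivlMr ?ltr0n// truncnS_gt. Qed.

(** [Y] stands for the partial sums, with [j = 1] and [c] the mean of a summand, and for the cross
    sums, with [j = 2] and [c] its square. *)
Variables (Y : nat -> T -> nat) (j : nat) (c : R).
Hypotheses (j0 : (0 < j)%N) (c0 : 0 <= c).
Hypothesis sY : forall n (B : set nat), sigma_of_family setT X (Y n @^-1` B).
Hypothesis YE : forall n,
  (\int[P]_w (Y n w)%:R%:E = ((n ^_ j)%:R * c)%:E)%E.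

Let mY n : measurable_fun setT (Y n).
Proof.
move=> _ B _; rewrite setTI.
have : sigma_of_family setT X `<=` measurable.
  apply: smallest_sub; first exact: sigma_algebra_measurable.
  move=> _ [i _ [C mC <-]]; exact: mX.
by apply; exact: sY.
Qed.

Lemma integral_poisson_time q : 0 <= q ->
  (\int[P]_w (Y (N q w) w)%:R%:E = ((lambda * q) ^+ j * c)%:E)%E.
Proof.
move=> q0; have mN := poisson_measurable hN q0.
rewrite (@integral_random_index _ _ _ P (N q) Y)//; last first.
  move=> k B; apply: hXN => //.
  exact: (@sigma_of_familyP _ T R (@times R) _ _ N q [set k] q0).
under eq_integral do rewrite /= YE EFinM.
rewrite ge0_integralZr//; last first.
  apply: measurable_EFin_natr.
  exact: (measurable_fun_nat_comp (fun k => k ^_ j)%N).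
by rewrite (integral_poisson_process hlambda hN).
Qed.

(** Conditioning on the discrete level freezes the sampling time at a grid point. The offset [b] is
    0 for the sample below [L t] and 1 for the one above. *)
Lemma integral_level m b t : 0 <= t ->
  (\int[P]_w (Y (N (grid R m (level m t w + b)) w) w)%:R%:E =
   \int[P]_w ((lambda * grid R m (level m t w + b)) ^+ j * c)%:E)%E.
Proof.
move=> t0.
rewrite (@integral_random_index _ _ _ P (level m t)
  (fun k w => Y (N (grid R m (k + b)) w) w)).
- by apply: eq_integral => w _; rewrite integral_poisson_time// grid_ge0.
- exact: measurable_level.
- move=> k; apply: measurable_fun_random_index => //.
  exact/(poisson_measurable hN)/grid_ge0.
move=> k B; rewrite setIC muleC; apply: hL; first exact: sigma_level.
(* The sampled variable is measurable for the sigma-algebra generated by [N] and [X] jointly, hence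
   its events are independent of the level. *)
set G := _ `|` _.
have mN' : measurable_fun setT
    (N (grid R m (k + b)) : g_sigma_algebraType G -> nat).
  apply: (@measurable_fun_sigma_of_family _ T R (@times R)).
    exact: grid_ge0.
  by move=> A NA; apply: sub_sigma_algebra; left.
have mY' n : measurable_fun setT (Y n : g_sigma_algebraType G -> nat).
  by move=> _ C _; rewrite setTI; apply: sub_sigma_algebra; right; exact: sY.
by have := measurable_fun_random_index mN' mY' measurableT (I : measurable B);
  rewrite setTI.
Qed.

End time_changed_moments.

(** * A measurable modification of the time-changed process *)

Section time_change_modification.
Context d (T : measurableType d) (R : realType) (P : probability T R).
Variables (lambda : R) (N : R -> T -> nat) (L : R -> T -> R).
Variables (Y : nat -> T -> nat) (t : R).
Hypothesis hN : poisson_process P lambda N.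
Hypotheses (mY : forall n, measurable_fun setT (Y n)).
Hypotheses (mL : measurable_fun setT (L t)) (L0 : forall w, 0 <= L t w).

Lemma measurable_time_change_grid m b :
  measurable_fun setT (fun w => Y (N (grid R m (level L m t w + b)) w) w).
Proof.
have ml : measurable_fun setT (level L m t).
  apply: measurableT_comp; first exact: measurable_truncn.
  exact: measurable_funM.
pose Z k w := Y (N (grid R m (k + b)) w) w.
have mZ k : measurable_fun setT (Z k).
  apply: measurable_fun_random_index => //.
  exact/(poisson_measurable hN)/grid_ge0.
exact: (measurable_fun_random_index ml mZ).
Qed.

(* Off a null set, the right-continuity of N makes Y (N (L t)) the limit of the
   measurable variables sampled at the grid points just above L t. *)
Lemma time_change_measurable_modification :
  exists W : T -> nat, measurable_fun setT W /\
    {ae P, forall w, W w = Y (N (L t w) w) w}.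
Proof.
have [B [mB PB0 Bsub]] := poisson_good_path hN.
pose S m w := Y (N (grid R m (level L m t w + 1)) w) w.
have mS m : measurable_fun setT (S m) by exact: measurable_time_change_grid.
pose V w := if w \in B then 0%N else Y (N (L t w) w) w.
exists V; split; last first.
  exists B; split => // w /=; apply: contra_notP => wB.
  by rewrite /V memNset.
rewrite (_ : V = Num.truncn \o (fun w => (V w)%:R : R)); last first.
  by apply/funext => w /=; rewrite natrK.
apply: measurableT_comp; first exact: measurable_truncn.
pose VS m w := (if w \in B then 0%N else S m w).
apply: (@measurable_fun_cvg _ _ _ _ (fun m w => (VS m w)%:R : R)).
  move=> m; apply: measurable_natr.
  apply: measurable_fun_ifT => //.
  apply: (measurable_fun_bool true); rewrite setTI.
  by rewrite (_ : _ @^-1` _ = B)//; apply/seteqP; split => w /=;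
    [exact: set_mem | exact: mem_set].
move=> w _; apply: cvg_near_cst; rewrite /VS /V.
case: ifPn => [_|wB]; first exact: nearW.
have [rc _] : good_path (N ^~ w).
  by apply: contrapT => ng; move/negP: wB; apply; apply/mem_set/Bsub.
have [e e0 Ne] := rc _ (L0 w).
(* From this index on the mesh is below [e], so the sample lies in the interval of constancy and
   equals its limit. *)
exists (Num.truncn e^-1) => // m /= em.
rewrite /S Ne// addn1 grid_level_gt/=.
have m0 : 0 < m.+1%:R :> R by rewrite ltr0n.
have me : 1 < e * m.+1%:R.
  rewrite mulrC -ltr_pdivrMr// div1r (lt_le_trans (truncnS_gt _))//.
  by rewrite ler_nat.
rewrite /grid ltr_pdivrMr// -natr1 mulrDl; apply: ler_ltD => //.
by rewrite truncn_le mulr_ge0.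
Qed.

End time_change_modification.

(** * The inverse stable subordinator *)

Section inverse_stable_subordinator.
Context d (T : measurableType d) (R : realType) (P : probability T R).
Variables (nu : R) (A : R -> T -> R).
Hypothesis hA : stable_subordinator P nu A.

Local Notation L := (inverse_process A).

Lemma inverse_process_ge0 t w : 0 <= L t w.
Proof.
rewrite /inverse_process;
  have [->|/set0P E0] := eqVneq [set z | 0 <= z /\ t < A z w] set0.
  by rewrite inf0.
by apply: lb_le_inf => // z [].
Qed.

Lemma inverse_process_gt t z w : 0 <= z -> z < L t w -> A z w <= t.
Proof.
move=> z0 zL; rewrite leNgt; apply/negP => tA.
move: zL; rewrite ltNge => /negP; apply; apply: ge_inf => //.
by exists 0 => y [].
Qed.

Lemma stable_measurable z : 0 <= z -> measurable_fun setT (A z).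
Proof. exact: (levy_measurable (stable_levy hA)). Qed.

Lemma measurable_stable_le t z : 0 <= z -> measurable [set w | A z w <= t].
Proof.
move=> z0; rewrite (_ : [set _ | _] = A z @^-1` `]-oo, t]%classic).
  by rewrite -[X in measurable X]setTI; exact: stable_measurable.
by apply/seteqP; split => w /=; rewrite in_itv.
Qed.

(** This is the exponential Markov inequality with parameter [-1], where the Laplace transform of
    [A z] is [expR (- z)]. *)
Lemma stable_lower_tail t z : 0 < z ->
  (P [set w | (A z w <= t)%R] <= (expR t * expR (- z))%:E)%E.
Proof.
move=> z0; have mA := stable_measurable (ltW z0).
have := @stable_mgf_le0 _ _ _ _ _ _ hA z (-1) z0.
rewrite oppr_le0 ler01 opprK powR1 mul1r => /(_ isT).
rewrite /mmt_gen_fun unlock EFinM => <-.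
have mE : measurable_fun setT (fun w => (expR (A z w * -1))%:E).
  apply/measurable_EFinP; apply: measurableT_comp => //.
  exact: measurable_funM.
rewrite -ge0_integralZl ?lee_fin ?expR_ge0//; last first.
  by move=> w _; rewrite lee_fin expR_ge0.
rewrite -(setIT [set w | A z w <= t]) -integral_indic//;
  last exact/measurable_stable_le/ltW.
apply: ge0_le_integral => //.
- apply/measurable_EFinP; apply: measurable_indic.
  exact/measurable_stable_le/ltW.
- exact: measurable_funeM.
- move=> w _; rewrite -EFinM lee_fin /= -expRD indicE.
  case: (boolP (w \in _)) => [/set_mem /= Aw|_]; last exact: expR_ge0.
  by rewrite mulr1n -[leLHS]expR0 ler_expR mulrN1 subr_ge0.
Qed.

(** On the exceptional set every [A n.+1%:R] is at most [t], which has probability at most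
    [expR t * expR (- n.+1%:R)] for every [n]. *)
Lemma inverse_process_nonempty t :
  {ae P, forall w, exists2 z, 0 <= z & t < A z w}.
Proof.
pose B := \bigcap_n [set w | A n.+1%:R w <= t].
have mB : measurable B by apply: bigcapT_measurable => n;
  exact: measurable_stable_le.
exists B; split => //; last first.
  move=> w /= nz n _ /=; rewrite leNgt; apply/negP => tA.
  by apply: nz; exists n.+1%:R.
apply/eqP; rewrite eq_le measure_ge0 andbT.
have Pfin := fin_num_measure P B mB.
rewrite -(fineK Pfin) lee_fin leNgt; apply/negP => p0.
set p := fine (P B) in p0 *.
(* Then [expR t / p < n + 1 < expR (n + 1)], so the tail bound falls below [p]. *)
pose n := Num.truncn (expR t / p).
have : p <= expR t * expR (- n.+1%:R).
  rewrite -lee_fin fineK//;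
    apply: (le_trans _ (stable_lower_tail t (ltr0Sn _ n))).
  by apply: le_measure; rewrite ?inE//;
    [exact: measurable_stable_le | exact: bigcap_inf].
apply/negP; rewrite -ltNge expRN ltr_pdivrMr ?expR_gt0// mulrC -ltr_pdivrMr//.
apply: (lt_le_trans (truncnS_gt _)).
by apply: le_trans (expR_ge1Dx _); rewrite lerDr.
Qed.

(** [L t] exceeds [z] only if [A z] is at most [t], so its tails decay geometrically; rounding down
    to an integer costs at most 1. *)
Lemma integral_inverse_process t : 0 <= t -> measurable_fun setT (L t) ->
  (\int[P]_w (L t w)%:E < +oo)%E.
Proof.
move=> t0 mL.
pose K w := Num.truncn (L t w).
have mK : measurable_fun setT K.
  by apply: measurableT_comp => //; exact: measurable_truncn.
apply: (@le_lt_trans _ _ (\int[P]_w ((K w)%:R%:E + 1)))%E.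
  apply: ge0_le_integral => //.
  - by move=> w _; rewrite lee_fin inverse_process_ge0.
  - exact/measurable_EFinP.
  - by apply: emeasurable_funD => //; exact: measurable_EFin_natr.
  - by move=> w _; rewrite -EFinD lee_fin natr1 ltW// truncnS_gt.
rewrite ge0_integralD//; last exact: measurable_EFin_natr.
have -> : (\int[P]_w 1 = 1 :> \bar R)%E.
  by rewrite (integral_cst P measurableT 1) mul1e /= probability_setT.
rewrite lte_add_pinfty ?ltry// integral_nat_tail//.
apply: (@le_lt_trans _ _
    (\sum_(n <oo) (geometric (expR t) (expR (-1)) n)%:E)%E).
  apply: lee_nneseries => // n _.
  (* The half gives a time that is positive even for [n = 0] and strictly below [n + 1]. *)
  have z0 : 0 < n%:R + 2^-1 :> R by rewrite ltr_wpDl.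
  apply: (@le_trans _ _ (P [set w | A (n%:R + 2^-1) w <= t])).
    apply: le_measure; rewrite ?inE.
    - exact: measurable_nat_preimage.
    - exact/measurable_stable_le/ltW.
    move=> w /=; rewrite truncn_gt_nat => nL.
    apply: inverse_process_gt; first exact: ltW.
    by apply: lt_le_trans nL; rewrite -[n.+1%:R]natr1 ltrD2l invf_lt1// ltr1n.
  apply: (le_trans (stable_lower_tail t z0)); rewrite lee_fin /=.
  rewrite ler_pM2l ?expR_gt0// -expRM_natl ler_expR mulrN1 lerN2.
  by rewrite lerDl.
have q1 : `|expR (-1)| < 1 :> R.
  by rewrite ger0_norm ?expR_ge0// -[ltRHS]expR0 ltr_expR ltrN10.
rewrite (_ : (fun n => _) =
    EFin \o series (geometric (expR t) (expR (-1)))); last first.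
  by apply/funext => n /=; rewrite sumEFin.
by rewrite EFin_lim ?ltry//; exact: is_cvg_geometric_series.
Qed.

(* The infinite moment generating function at 1 excludes a positive constant;
   right-continuity at the origin excludes a nonpositive one. *)
Lemma inverse_process_nondegenerate t (c : R) : 0 < t ->
  ~ {ae P, forall w, L t w = c}.
Proof.
move=> t0 Lc; have PT : (0 < P setT)%E by rewrite probability_setT.
have [c0|c0] := ltP 0 c.
  (* At half the constant the subordinator is almost surely at most [t], so its moment generating
     function at 1 is at most [expR t]. *)
  have z0 : 0 < c / 2 by rewrite divr_gt0.
  have mA := stable_measurable (ltW z0).
  have At : {ae P, forall w, A (c / 2) w <= t}.
    apply: filterS Lc => w Lw; apply: inverse_process_gt; first exact: ltW.
    by rewrite Lw ltr_pdivrMr// ltr_pMr// ltr1n.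
  have := @stable_mgf_gt0 _ _ _ _ _ _ hA (c / 2) 1 z0 ltr01.
  rewrite /mmt_gen_fun unlock => Moo.
  suff : (+oo <= (expR t)%:E :> \bar R)%E by rewrite leye_eq.
  rewrite -Moo.
  have -> : (expR t)%:E = (\int[P]_w (cst (expR t)%:E) w)%E.
    by rewrite integral_cst//= probability_setT mule1.
  apply: ae_ge0_le_integral => //.
  - by move=> w _; rewrite lee_fin expR_ge0.
  - apply/measurable_EFinP; apply: measurableT_comp => //.
    exact: measurable_funM.
  - by move=> w _; rewrite lee_fin expR_ge0.
  by apply: filterS At => w Aw _; rewrite lee_fin ler_expR /= mulr1.
(* An almost sure property holds at some point, and a single path gives the contradiction. *)
have PF := ae_properfilter_algebraOfSetsType PT.
have good : {ae P, forall w, [/\ exists2 z, 0 <= z & t < A z w, L t w = c,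
    A 0 w = 0 & cadlag (A ^~ w)]}.
  near=> w; split; near: w => //.
  - exact: inverse_process_nonempty.
  - exact: (levy_start (stable_levy hA)).
  - exact: (levy_paths (stable_levy hA)).
have [w [[z0 z00 tA] Lw A0 [rc _]]] := @filter_ex _ _ PF _ good.
have /cvgrPdist_lt /(_ t t0)[e /= e0 Ae] := rc 0 (lexx 0).
suff : e <= c by rewrite leNgt (le_lt_trans c0).
(* The time [z0] makes the set nonempty, so the infimum is not the default value 0; every element is
   at least [e], since the path stays below [t] before [e]. *)
rewrite -Lw; apply: lb_le_inf; first by exists z0.
move=> z [z_ge0 tz]; rewrite leNgt; apply/negP => ze.
move: z_ge0; rewrite le_eqVlt => /predU1P[z_eq|z_gt].
  by move: tz; rewrite -z_eq A0 ltNge ltW.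
have := Ae z; rewrite /ball/= sub0r normrN gtr0_norm// => /(_ ze z_gt).
rewrite A0 sub0r normrN => h.
by have := lt_trans tz (le_lt_trans (ler_norm _) h); rewrite ltxx.
Unshelve. all: by end_near. Qed.

End inverse_stable_subordinator.

(** * Variance against mean *)

Section integral_ae_without_measurability.
Local Open Scope ereal_scope.
Context d (T : measurableType d) (R : realType).
Variable mu : {measure set T -> \bar R}.
Import HBNNSimple.

(* The integral is a supremum over simple functions, which can be set to 0 on
   the exceptional set. *)
Lemma ge0_ae_le_integral_nomeas (f g : T -> \bar R) :
  (forall x, 0 <= f x) -> (forall x, 0 <= g x) ->
  {ae mu, forall x, f x <= g x} -> \int[mu]_x f x <= \int[mu]_x g x.
Proof.
move=> f0 g0 [B [mB muB0 Bsub]].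
rewrite ge0_integralTE//; apply: ge_ereal_sup => _ [h hf <-].
pose k := proj_nnsfun h (measurableC mB).
have kE x : k x = (if x \in B then 0 else h x)%R.
  by rewrite -mrestrict patchE in_setC; case: (x \in B).
rewrite -integralT_nnsfun (_ : \int[mu]_x (h x)%:E = \int[mu]_x (k x)%:E).
  rewrite integralT_nnsfun ge0_integralTE//; apply: ereal_sup_ubound.
  exists k => // x; rewrite kE; case: ifPn => [_|xB]; first exact: g0.
  apply: (le_trans (hf x)); apply: contrapT => nle.
  by move/negP: xB; apply; apply/mem_set/Bsub.
apply: ae_eq_integral => //; [exact/measurable_EFinP..|].
exists B; split => // x; apply: contra_notP => xB _.
by congr EFin; rewrite kE memNset.
Qed.

(** Positive and negative parts reduce this to two opposite inequalities between nonnegative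
    functions. *)
Lemma ae_eq_integral_nomeas (f g : T -> \bar R) :
  {ae mu, forall x, f x = g x} -> \int[mu]_x f x = \int[mu]_x g x.
Proof.
move=> fg; rewrite integralE [RHS]integralE.
have eq_ge0 (u v : T -> \bar R) : (forall x, 0 <= u x) ->
  (forall x, 0 <= v x) ->
    {ae mu, forall x, u x = v x} -> \int[mu]_x u x = \int[mu]_x v x.
  move=> u0 v0 uv; apply/eqP; rewrite eq_le; apply/andP; split.
    by apply: ge0_ae_le_integral_nomeas => //; apply: filterS uv => x ->.
  by apply: ge0_ae_le_integral_nomeas => //; apply: filterS uv => x ->.
congr (_ - _).
  by apply: eq_ge0 => //; apply: filterS fg => x; rewrite !funeposE => ->.
by apply: eq_ge0 => //; apply: filterS fg => x; rewrite !funenegE => ->.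
Qed.

End integral_ae_without_measurability.

(** * A second-moment criterion for overdispersion *)

Section overdispersion_criterion.
Context d (T : measurableType d) (R : realType) (P : probability T R).

(** This carries the conclusion from a measurable modification back to the time-changed process
    itself. *)
Lemma overdispersed_ae (Y Z : T -> R) :
  {ae P, forall w, Y w = Z w} -> overdispersed P Z -> overdispersed P Y.
Proof.
move=> YZ; rewrite /overdispersed /variance.
have EE : ('E_P[Y] = 'E_P[Z])%E.
  by rewrite unlock; apply: ae_eq_integral_nomeas; apply: filterS YZ => w ->.
suff -> : covariance P Y Y = covariance P Z Z by rewrite EE.
rewrite unlock EE; set E := (fine _); rewrite unlock.
apply: ae_eq_integral_nomeas; apply: filterS YZ => w YZw.
by congr EFin; rewrite -[LHS]/((Y w - E) * (Y w - E)) YZw.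
Qed.

Lemma ge0_integrable_Lfun1 (Y : T -> R) : measurable_fun setT Y ->
  (forall w, 0 <= Y w) -> (\int[P]_w (Y w)%:E < +oo)%E -> Y \in Lfun P 1.
Proof.
move=> mY Y0 Yoo; apply/Lfun1_integrable/integrableP; split.
  exact/measurable_EFinP.
by under eq_integral => w _ do rewrite /= ger0_norm//.
Qed.

Lemma variance_sqr (Y : T -> R) : measurable_fun setT Y ->
  (forall w, 0 <= Y w) -> (\int[P]_w (Y w)%:E < +oo)%E ->
  (\int[P]_w (Y w ^+ 2)%:E < +oo)%E ->
  ('V_P[Y] = \int[P]_w (Y w ^+ 2)%:E - 'E_P[Y] ^+ 2)%E.
Proof.
move=> mY Y0 Y1 Y2; have LY := ge0_integrable_Lfun1 mY Y0 Y1.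
rewrite /variance covarianceE//.
  by congr (_ - _)%E; rewrite unlock.
apply: ge0_integrable_Lfun1; first exact: measurable_funM.
  by move=> w; rewrite mulr_ge0.
by [].
Qed.

(** If the integral of the squared deviation vanishes, the deviation is almost surely zero. *)
Lemma variance_gt0 (Y : T -> R) : measurable_fun setT Y ->
  ~ {ae P, forall w, Y w = fine ('E_P[Y])%E} -> (0 < 'V_P[Y])%E.
Proof.
move=> mY; rewrite lt0e variance_ge0 andbT => nondeg; apply/eqP => V0.
apply: nondeg; set E := fine _ in V0 *.
move: V0; rewrite /variance unlock -/E unlock => V0.
have mf : measurable_fun setT (fun w => (((Y \- cst E) * (Y \- cst E)) w)%:E).
  apply/measurable_EFinP; apply: measurable_funM; exact: measurable_funB.
have := (ae_eq_integral_abs P measurableT mf).1.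
under eq_integral => w _ do rewrite /= ger0_norm ?sqr_ge0//.
move=> /(_ V0); apply: filterS => w /(_ I) /= [] /eqP.
by rewrite mulf_eq0 orbb subr_eq0 => /eqP.
Qed.

(* In the application [a] is the product of the Poisson intensity and the mean
   of a summand. *)
Lemma overdispersion_criterion (Y l : T -> R) (a : R) : 0 < a ->
  measurable_fun setT Y -> (forall w, 0 <= Y w) ->
  measurable_fun setT l -> (forall w, 0 <= l w) ->
  (\int[P]_w (l w)%:E < +oo)%E -> (forall c, ~ {ae P, forall w, l w = c}) ->
  (\int[P]_w (Y w)%:E <= a%:E * \int[P]_w (l w)%:E)%E ->
  ((a ^+ 2)%:E * \int[P]_w (l w ^+ 2)%:E + \int[P]_w (Y w)%:E
    <= \int[P]_w (Y w ^+ 2)%:E)%E ->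
  overdispersed P Y.
Proof.
move=> a0 mY Y0 ml l0 loo nondeg Yle lY2.
have el0 : (0 <= \int[P]_w (l w)%:E)%E by apply: integral_ge0 => w _;
  rewrite lee_fin.
have ey0 : (0 <= \int[P]_w (Y w)%:E)%E by apply: integral_ge0 => w _;
  rewrite lee_fin.
have el20 : (0 <= \int[P]_w (l w ^+ 2)%:E)%E.
  by apply: integral_ge0 => w _; rewrite lee_fin sqr_ge0.
have ey20 : (0 <= \int[P]_w (Y w ^+ 2)%:E)%E.
  by apply: integral_ge0 => w _; rewrite lee_fin sqr_ge0.
have Yoo : (\int[P]_w (Y w)%:E < +oo)%E.
  by apply: (le_lt_trans Yle); rewrite lte_mul_pinfty// lee_fin ltW.
rewrite /overdispersed.
have EY : ('E_P[Y] = (fine (\int[P]_w (Y w)%:E))%:E)%E.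
  by rewrite unlock fineK// ge0_fin_numE.
have El : ('E_P[l] = (fine (\int[P]_w (l w)%:E))%:E)%E.
  by rewrite unlock fineK// ge0_fin_numE.
(* The mean is finite, so an infinite variance settles the claim. *)
have [Voo|Vfin] := eqVneq ('V_P[Y])%E +oo%E.
  by rewrite Voo EY ltry.
have Y2oo : (\int[P]_w (Y w ^+ 2)%:E < +oo)%E.
  have {}Vfin : ('V_P[Y] < +oo)%E by rewrite ltey.
  move: Vfin; rewrite /variance unlock EY /=.
  set e := fine _; rewrite unlock => Vfin.
  have mc : measurable_fun setT
      (fun w => (((Y \- cst e) * (Y \- cst e)) w)%:E).
    by apply/measurable_EFinP; apply: measurable_funM; exact: measurable_funB.
  have c0 w : (0 <= (((Y \- cst e) * (Y \- cst e)) w)%:E)%E.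
    by rewrite lee_fin sqr_ge0.
  (* The second moment is finite because [Y ^+ 2 <= 2 * (Y - e) ^+ 2 + 2 * e ^+ 2], which amounts to
     [0 <= (Y - 2 * e) ^+ 2]. *)
  apply: (@le_lt_trans _ _ (\int[P]_w (2%:E *
      (((Y \- cst e) * (Y \- cst e)) w)%:E + (cst (2 * e ^+ 2)%:E) w)))%E.
    apply: ge0_le_integral => //.
    - by move=> w _; rewrite lee_fin sqr_ge0.
    - by apply/measurable_EFinP; exact: measurable_funX.
    - by apply: emeasurable_funD => //; exact: measurable_funeM.
    - move=> w _; rewrite -EFinM -EFinD lee_fin.
      rewrite -[leRHS]/(2 * ((Y w - e) * (Y w - e)) + 2 * e ^+ 2).
      have := sqr_ge0 (Y w - 2 * e); nra.
  rewrite ge0_integralD//; last 3 first.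
  - by move=> w _; rewrite mule_ge0.
  - exact: measurable_funeM.
  - by move=> w _; rewrite lee_fin mulr_ge0 ?sqr_ge0.
  rewrite ge0_integralZl// integral_cst//= probability_setT mule1.
  by rewrite lte_add_pinfty ?ltry// lte_mul_pinfty.
have l2oo : (\int[P]_w (l w ^+ 2)%:E < +oo)%E.
  have a20 : 0 < a ^+ 2 by rewrite exprn_gt0.
  have h : ((a ^+ 2)%:E * \int[P]_w (l w ^+ 2)%:E < +oo)%E.
    by apply: le_lt_trans Y2oo; apply: le_trans lY2; rewrite leeDl.
  rewrite ltey; apply/eqP => l2; move: h.
  by rewrite l2 gt0_muley ?lte_fin.
have := variance_gt0 ml (nondeg _).
rewrite !variance_sqr// EY El.
move: lY2 Yle.
have fin (x : \bar R) : (0 <= x)%E -> (x < +oo)%E -> x = (fine x)%:E.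
  by move=> x0 xoo; rewrite fineK// ge0_fin_numE.
rewrite (fin _ el0 loo) (fin _ ey0 Yoo) (fin _ el20 l2oo) (fin _ ey20 Y2oo) /=.
move: (fine_ge0 el0) (fine_ge0 ey0).
set l1 := fine _; set y1 := fine _; set l2 := fine _; set y2 := fine _.
rewrite -?EFinB -!EFinM -!EFinD -?EFinB !lee_fin !lte_fin =>
  l1_ge0 y1_ge0 hy2 hy1 hl.
(* In real numbers, [y2 - y1 ^+ 2 - y1] is at least [a ^+ 2] times the variance of [l]. *)
have : y1 * y1 <= (a * l1) * (a * l1) by exact: ler_pM.
have : 0 < a ^+ 2 * (l2 - l1 * l1) by rewrite mulr_gt0// exprn_gt0.
lra.
Qed.

End overdispersion_criterion.

(** * The time-changed compound process *)

Section compound_facts.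
Context d (T : measurableType d) (X : nat -> T -> nat).

Lemma measurable_psum n :
  (forall k, measurable_fun setT (X k)) -> measurable_fun setT (psum X n).
Proof. by move=> mX; exact: measurable_fun_nat_sum. Qed.

Lemma measurable_cross n :
  (forall k, measurable_fun setT (X k)) -> measurable_fun setT (cross X n).
Proof.
move=> mX; do 2 (apply: measurable_fun_nat_sum => ?).
exact: (measurable_fun_nat_comp2 muln).
Qed.

End compound_facts.

Section sigma_partial_sums.
Context d (T : measurableType d) (X : nat -> T -> nat).

Let mX k : measurable_fun setT
  (X k : g_sigma_algebraType (\bigcup_(i in setT) sigma_of (X i)) -> nat).
Proof. exact: (@measurable_fun_sigma_of_family _ T nat setT). Qed.

Lemma sigma_psum n (B : set nat) : sigma_of_family setT X (psum X n @^-1` B).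
Proof. exact: (measurable_nat_preimage B (measurable_psum n mX)). Qed.

Lemma sigma_cross n (B : set nat) : sigma_of_family setT X (cross X n @^-1` B).
Proof. exact: (measurable_nat_preimage B (measurable_cross n mX)). Qed.

End sigma_partial_sums.

Lemma exists_div_le (R : realType) (x e : R) : 0 <= x -> 0 < e ->
  exists m, x / m.+1%:R <= e.
Proof.
move=> x0 e0; exists (Num.truncn (x / e)).
by rewrite ler_pdivrMr// mulrC -ler_pdivrMr// ltW// truncnS_gt.
Qed.

Theorem mainTheorem2 (d : measure_display) (T : measurableType d)
  (R : realType) (P : probability T R) (nu lambda : R)
  (N : R -> T -> nat) (X : nat -> T -> nat) (A : R -> T -> R)
  (hnu : 0 < nu < 1) (hlambda : 0 < lambda)
  (hN : poisson_process P lambda N)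
  (hX_iid : iid P X)
  (hX_pos : forall n : nat, {ae P, forall w, (0 < X n w)%N})
  (hX_mean : ('E_P[fun w => (X 0%N w)%:R] < +oo)%E)
  (hXN : independent_systems P (sigma_of_family setT X)
                               (sigma_of_family (@times R) N))
  (hA : stable_subordinator P nu A)
  (hL_meas : forall t : R, 0 <= t -> measurable_fun setT (inverse_process A t))
  (hL : independent_systems P
          (sigma_of_family (@times R) (inverse_process A))
          <<s sigma_of_family (@times R) N `|` sigma_of_family setT X >>) :
  exhibits_overdispersion P
    (time_change (@compound_process d T R N X) (inverse_process A)).
Proof.
move=> t t_gt0; have t0 := ltW t_gt0.
have mX := iid_measurable hX_iid.
set L := inverse_process A in hL_meas hL *.
have L0 w : 0 <= L t w by exact: inverse_process_ge0.
have mL := hL_meas _ t0.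
have X_fin : (\int[P]_w (X 0%N w)%:R%:E \is a @fin_num R)%E.
  rewrite ge0_fin_numE; first by move: hX_mean; rewrite unlock.
  by apply: integral_ge0 => w _; rewrite lee_fin.
pose mu : R := fine (\int[P]_w (X 0%N w)%:R%:E)%E.
have mu_gt0 : 0 < mu.
  (* A summand is almost surely at least 1, hence so is its mean. *)
  apply: (@lt_le_trans _ _ 1) => //; rewrite -lee_fin fineK//.
  have -> : (1 = \int[P]_w (cst 1 w) :> \bar R)%E.
    by rewrite integral_cst//= probability_setT mule1.
  apply: ae_ge0_le_integral => //; first exact: measurable_EFin_natr.
  by apply: filterS (hX_pos 0%N) => w Xw _; rewrite lee_fin ler1n.
have [W [mW WE]] := time_change_measurable_modification hN
  (fun n => measurable_psum n mX) mL L0.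
apply: (@overdispersed_ae _ _ _ _ _ (fun w => (W w)%:R)).
  by apply: filterS WE => w ->.
have a0 : 0 < lambda * mu by rewrite mulr_gt0.
have good := poisson_good_path hN.
have mgrid m b j c : measurable_fun setT
    (fun w => ((lambda * grid R m (level L m t w + b)) ^+ j * c)%:E).
  apply/measurable_EFinP.
  apply: (measurable_fun_nat_comp
    (fun k => (lambda * grid R m (k + b)) ^+ j * c)).
  exact: measurable_level.
have L_fin := integral_inverse_process hA t0 mL.
have L_ge0 : (0 <= \int[P]_w (L t w)%:E)%E.
  by apply: integral_ge0 => w _; rewrite lee_fin.
have LE : (\int[P]_w (L t w)%:E = (fine (\int[P]_w (L t w)%:E))%:E)%E.
  by rewrite fineK// ge0_fin_numE.
apply: (@overdispersion_criterion _ _ _ _ _ (L t) (lambda * mu)) => //.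
- exact: measurable_natr.
- by move=> c; exact: (inverse_process_nondegenerate hA).
(* Upper bound for the mean: the grid point just above [L t] overshoots by at most the mesh, which
   costs [lambda * mu / m.+1%:R]. *)
- apply/lee_addgt0Pr => e e0.
  have [m me] := exists_div_le (ltW a0) e0.
  apply: (@le_trans _ _ (\int[P]_w
      (psum X (N (grid R m (level L m t w + 1)) w) w)%:R%:E)%E).
    apply: ae_ge0_le_integral => //; [exact: measurable_EFin_natr| |].
      apply: measurable_EFin_natr;
        apply: (measurable_time_change_grid hN) => //.
      by move=> n; exact: measurable_psum.
    near=> w => _; rewrite lee_fin ler_nat.
    have -> : W w = psum X (N (L t w) w) w by near: w.
    apply: psum_mono; apply: (@good_path_le_grid _ (N ^~ w)) => //;
      first by near: w.
    by rewrite addn1 grid_level_gt.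
  rewrite (integral_level hlambda hN mX hXN hL_meas hL (j := 1) (c := mu))//;
    last 3 first.
  - exact: ltW.
  - exact: sigma_psum.
  - by move=> n; exact: integral_psum.
  apply: (@le_trans _ _ (\int[P]_w
      ((lambda * mu)%:E * (L t w)%:E + (cst e%:E) w))%E).
    apply: ge0_le_integral => //.
    - by move=> w _; rewrite lee_fin expr1 !mulr_ge0 ?grid_ge0// ltW.
    - apply: emeasurable_funD => //; apply: measurable_funeM.
      exact/measurable_EFinP.
    - move=> w _; rewrite -EFinM -EFinD lee_fin expr1 /= mulrAC.
      apply: (@le_trans _ _ (lambda * mu * (L t w) + lambda * mu / m.+1%:R)).
        rewrite -mulrDr ler_pM2l// addn1 /grid -natr1 mulrDl mul1r lerD2r.
        exact: grid_level_le.
      by rewrite lerD2l.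
  rewrite ge0_integralD//; last 3 first.
  - by move=> w _; rewrite mule_ge0 ?lee_fin// ltW.
  - by apply: measurable_funeM; exact/measurable_EFinP.
  - by move=> w _; rewrite lee_fin ltW.
  rewrite ge0_integralZl//; last 3 first.
  - exact/measurable_EFinP.
  - by move=> w _; rewrite lee_fin.
  - by rewrite lee_fin ltW.
  by rewrite integral_cst//= probability_setT mule1.
(* Lower bound for the second moment: the cross sum is sampled at the grid point just below [L t],
   hence the offset 0. *)
- apply/lee_addgt0Pr => e e0.
  set a := lambda * mu in a0 *.
  set l := fine _ in LE.
  have l0 : 0 <= l by rewrite -lee_fin -LE.
  (* With [l] the mean of [L t], this bounds the loss from replacing the square of [L t] by that of
     the grid point. *)
  have [m me] : exists m, a ^+ 2 * 2 * l / m.+1%:R <= e.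
    by apply: exists_div_le => //; rewrite !mulr_ge0// ltW.
  pose C w := cross X (N (grid R m (level L m t w + 0)) w) w.
  have mC : measurable_fun setT C.
    apply: (measurable_time_change_grid hN) => // n; exact: measurable_cross.
  have CE : (\int[P]_w (C w)%:R%:E = \int[P]_w
      ((lambda * grid R m (level L m t w + 0)) ^+ 2 * mu ^+ 2)%:E)%E.
    rewrite (integral_level hlambda hN mX hXN hL_meas hL (j := 2) (c :=
      mu ^+ 2))//.
    - by rewrite sqr_ge0.
    - exact: sigma_cross.
    - by move=> n; exact: integral_cross.
  have h1 : ((a ^+ 2)%:E * \int[P]_w (L t w ^+ 2)%:E <=
      \int[P]_w (C w)%:R%:E + e%:E)%E.
    have mL2 : measurable_fun setT (fun w => (L t w ^+ 2)%:E).
      by apply/measurable_EFinP; exact: measurable_funX.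
    rewrite -ge0_integralZl//; last 2 first.
    - by move=> w _; rewrite lee_fin sqr_ge0.
    - by rewrite lee_fin sqr_ge0.
    have k0 : 0 <= a ^+ 2 * 2 / m.+1%:R
      by rewrite divr_ge0// mulr_ge0// sqr_ge0.
    apply: (@le_trans _ _ (\int[P]_w
        (((lambda * grid R m (level L m t w + 0)) ^+ 2 * mu ^+ 2)%:E +
         (a ^+ 2 * 2 / m.+1%:R)%:E * (L t w)%:E))%E).
      apply: ge0_le_integral => //.
      - by move=> w _; rewrite -EFinM lee_fin mulr_ge0 ?sqr_ge0.
      - exact: measurable_funeM.
      - apply: emeasurable_funD; first exact: mgrid.
        by apply: measurable_funeM; exact/measurable_EFinP.
      move=> w _; rewrite -!EFinM -EFinD lee_fin addn0.
      have := grid_level_le m (L0 w); have := grid_level_gt L m t w.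
      have := grid_ge0 R m (level L m t w).
      rewrite {2}/grid -natr1 mulrDl mul1r -/(grid _ _ _).
      set g := grid _ _ _; set i := _^-1; set x := L t w => g0 xg gx.
      rewrite [leRHS](_ : _ = a ^+ 2 * (g ^+ 2 + 2 * i * x)); last first.
        by rewrite /a; ring.
      rewrite ler_pM2l ?exprn_gt0//.
      have i0 : 0 <= i by rewrite invr_ge0.
      have x0 := L0 w : 0 <= x.
      (* From [g <= x <= g + i] follows [x ^+ 2 - g ^+ 2 <= i * (x + g) <= 2 * i * x]. *)
      have h1 : 0 <= (g + i - x) * (x + g).
        by apply: mulr_ge0; [rewrite subr_ge0 ltW | exact: addr_ge0].
      have h2 : 0 <= i * (x - g) by rewrite mulr_ge0 ?subr_ge0.
      nra.
    rewrite ge0_integralD//; last 3 first.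
    - by move=> w _; rewrite lee_fin mulr_ge0 ?sqr_ge0.
    - by move=> w _; rewrite mule_ge0 ?lee_fin.
    - by apply: measurable_funeM; exact/measurable_EFinP.
    rewrite -CE leeD2l// ge0_integralZl//; last 2 first.
    - exact/measurable_EFinP.
    - by move=> w _; rewrite lee_fin.
    by rewrite LE -EFinM lee_fin mulrAC.
  apply: (@le_trans _ _ (\int[P]_w (C w)%:R%:E + e%:E + \int[P]_w (W
    w)%:R%:E)%E).
    exact: leeD2r.
  rewrite addeAC leeD2r// -ge0_integralD//; last 2 first.
  - exact: measurable_EFin_natr.
  - exact: measurable_EFin_natr.
  apply: ae_ge0_le_integral => //.
  - by move=> w _; rewrite -EFinD lee_fin addr_ge0.
  - by apply: emeasurable_funD; exact: measurable_EFin_natr.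
  - apply/measurable_EFinP; apply: measurable_funX; exact: measurable_natr.
  near=> w => _; rewrite -EFinD lee_fin -natrD -natrX ler_nat.
  have Ww : W w = psum X (N (L t w) w) w by near: w.
  (* The sampled cross sum is at most the one at [L t], since the path does not decrease from the
     grid point to [L t]. *)
  rewrite Ww -mulnn; apply: leq_trans (cross_psum _ _ _).
  rewrite leq_add2r; apply: cross_mono;
    apply: (@good_path_grid_le _ (N ^~ w)) => //.
    by near: w.
  by rewrite addn0; exact: grid_level_le.
Unshelve. all: by end_near. Qed.
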